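(* For every nonnegative integer $n$ and every integer $p>0$: $$\sum_{k=0}^n \frac{1}{k+p}H_{n-k} = H_{n+1} \,( H_{n+p} - H_{p-1} ) - \frac{1}{2}\left[ H_{n+1}^2 - H_{n+p}^2 + H_{n+1}^{(2)} + H_{n+p}^{(2)} \right] - \sum_{k=0}^{p-2} \frac{1}{n+k+2} H_k .$$
   Context: For a nonnegative integer $n$ and a positive integer $m$, the generalized harmonic number is $H_n^{(m)} = \sum_{k=1}^n \frac{1}{k^m}$, so that $H_0^{(m)}=0$. The traditional harmonic number is $H_n = H_n^{(1)}$. $H_n^2$ denotes the ordinary square $(H_n)^2$, while the parenthesized superscript in $H_n^{(2)}$ denotes the order. Empty sums (upper limit less than lower limit) are zero. *)

(* Defs.v *)
From mathcomp Require Import all_boot all_order all_algebra.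

Set Implicit Arguments.
Unset Strict Implicit.
Unset Printing Implicit Defensive.

Import GRing.Theory Num.Theory.
Local Open Scope ring_scope.

Definition gharm (m n : nat) : rat := \sum_(1 <= k < n.+1) 1 / k%:R ^+ m.

Definition harm (n : nat) : rat := gharm 1 n.

(* Main.v *)
Require Import Defs.
From mathcomp Require Import all_boot all_order all_algebra.
From mathcomp Require Import ring.

Import GRing.Theory Num.Theory.
Local Open Scope ring_scope.

(** Write [S n p] for the left-hand side and [N = n + p].  Then [S n p] is
    the sum of [1 / j * harm (N - j)] over [p <= j <= N], so along the
    antidiagonal [n + p = N] the sums differ by their lowest terms only:
    [S n.+1 p = S n p.+1 + harm n.+1 / p].  With [S 0 p = 0] this recurrence
    determines [S], by induction on [n] for all [p > 0] at once.  It therefore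
    suffices that the right-hand side vanishes at [n = 0]
    ([convolution_closed0]) and obeys the same recurrence
    ([convolution_closedS]).

    The recurrence for the right-hand side is algebra apart from its last sum,
    where [p] is raised while [n] is lowered.  Shifting the index of one of the
    two sums turns their difference into
    [\sum_(k < q) 1 / (k.+1 * (n + k + 3))], which decomposes by partial
    fractions into harmonic numbers ([harm_tail_sum_shift]). *)

Lemma gharm0 m : gharm m 0 = 0.
Proof. by rewrite /gharm big_nil. Qed.

Lemma gharmS m n : gharm m n.+1 = gharm m n + 1 / n.+1%:R ^+ m.
Proof. by rewrite /gharm big_nat_recr. Qed.

Lemma harm0 : harm 0 = 0.
Proof. exact: gharm0. Qed.

Lemma harmS n : harm n.+1 = harm n + 1 / n.+1%:R.
Proof. by rewrite /harm gharmS expr1. Qed.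

(** The right-hand side at the shift [p = q.+1], which removes the truncated
    subtractions [p - 1]. *)
Definition convolution_closed (n q : nat) : rat :=
  harm n.+1 * (harm (n + q).+1 - harm q)
  - 1 / 2 * (harm n.+1 ^+ 2 - harm (n + q).+1 ^+ 2
             + gharm 2 n.+1 + gharm 2 (n + q).+1)
  - \sum_(0 <= k < q) 1 / (n + k).+2%:R * harm k.

Lemma convolution_closed0 q : convolution_closed 0 q = 0.
Proof.
elim: q => [|q IHq].
  by rewrite /convolution_closed big_nil !harmS !gharmS harm0 gharm0.
rewrite -{}[RHS]IHq /convolution_closed big_nat_recr //= !add0n.
rewrite !harmS !gharmS harm0 gharm0.
by field; rewrite ?nat1r -?natrD !pnatr_eq0.
Qed.

(** After the index of the first sum is shifted, the terms contain
    [harm k.+1 - harm k = 1 / k.+1], so the difference equals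
    [\sum_(k < q) 1 / (k.+1 * (n + k + 3))], and
    [1 / (k.+1 * (n + k + 3)) = (1 / k.+1 - 1 / (n + k + 3)) / (n + 2)]
    sums to harmonic numbers.  The shift of index uses [harm 0 = 0]. *)
Lemma harm_tail_sum_shift n q :
  \sum_(0 <= k < q.+1) 1 / (n + k).+2%:R * harm k
  - \sum_(0 <= k < q) 1 / (n.+1 + k).+2%:R * harm k
  = (harm q - harm (n + q).+2 + harm n.+2) / n.+2%:R.
Proof.
elim: q => [|q IHq].
  by rewrite big_nat1 big_nil harm0 addn0 mulr0 subr0 sub0r addNr mul0r.
rewrite big_nat_recr // [X in _ - X]big_nat_recr //=.
rewrite opprD addrACA IHq addnS !addSn !(harmS q) (harmS (n + q).+2).
by field; rewrite ?nat1r -?natrD !pnatr_eq0.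
Qed.

Lemma convolution_closedS n q :
  convolution_closed n.+1 q
  = convolution_closed n q.+1 + 1 / q.+1%:R * harm n.+1.
Proof.
have shift := harm_tail_sum_shift n q.
rewrite /convolution_closed (canRL (subrK _) shift) addnS !addSn.
rewrite !(harmS q) !(harmS n.+1) !(gharmS _ n.+1).
by field; rewrite ?nat1r -?natrD !pnatr_eq0.
Qed.

Lemma convolution_harmE n q :
  \sum_(0 <= k < n.+1) 1 / (k + q.+1)%:R * harm (n - k)
  = convolution_closed n q.
Proof.
elim: n q => [|n IHn] q.
  by rewrite big_nat1 harm0 mulr0 convolution_closed0.
rewrite convolution_closedS -IHn big_nat_recl // add0n subn0 addrC.
congr (_ + _); apply: eq_bigr => k _.
by rewrite subSS addSnnS.
Qed.

Theorem theorem2p2 (n p : nat) (hp : (0 < p)%N) :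
  \sum_(0 <= k < n.+1) 1 / (k + p)%:R * harm (n - k) =
    harm (n + 1) * (harm (n + p) - harm (p - 1))
    - 1 / 2 * (harm (n + 1) ^+ 2 - harm (n + p) ^+ 2
               + gharm 2 (n + 1) + gharm 2 (n + p))
    - \sum_(0 <= k < p - 1) 1 / (n + k + 2)%:R * harm k.
Proof.
case: p hp => // q _.
rewrite convolution_harmE /convolution_closed addn1 addnS subn1 /=.
by congr (_ - _); apply: eq_bigr => k _; rewrite addn2.
Qed.
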